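(* Fix an integer $n\ge 2$. For $Q\in\mathbb{N}$ let $\xi_{Q,0},\dots,\xi_{Q,n}$ be independent random variables, each uniformly distributed on the integer set $\{-Q,-Q+1,\dots,Q\}$, and let $G_Q(x)=\xi_{Q,n}x^n+\dots+\xi_{Q,1}x+\xi_{Q,0}$. Let $\xi_0,\dots,\xi_n$ be independent random variables, each uniformly distributed on $[-1,1]$, let $G(x)=\xi_nx^n+\dots+\xi_1x+\xi_0$, and let $\varphi$ be the probability density of the random variable $D(G)$. Then there exists a constant $C_n>0$ depending only on $n$ such that for all $Q\ge 2$, $$\sup_{-\infty\le a\le b\le\infty}\left|\mathbb{P}\left(a\le \frac{D(G_Q)}{Q^{2n-2}}\le b\right)-\int_a^b\varphi(x)\,dx\right|\le \frac{C_n}{\log Q}.$$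
   Context: For a polynomial $p(x)=a_nx^n+\dots+a_0$ with $a_n\neq 0$ and complex roots $\alpha_1,\dots,\alpha_n$ (with multiplicity), the discriminant is $D(p)=a_n^{2n-2}\prod_{1\le i<j\le n}(\alpha_i-\alpha_j)^2$; this is a homogeneous polynomial of degree $2n-2$ in the coefficients $(a_0,\dots,a_n)$, and $D(p)$ is defined for every coefficient vector $(a_0,\dots,a_n)$ (including $a_n=0$) as the value of this polynomial. The paper refers to $\varphi$ as the ''distribution function'' of $D(G)$ but uses it as a density (it has compact support and is bounded). *)

(* Defs.v *)
From mathcomp Require Import all_boot all_order all_algebra ring complex.
From mathcomp Require mpoly.

Set Implicit Arguments.
Unset Strict Implicit.
Unset Printing Implicit Defensive.

Import Order.TTheory GRing.Theory Num.Theory.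
Local Open Scope ring_scope.
Local Open Scope complex_scope.

(* The notations of [mpoly] clash with those of MathComp-Analysis, hence this
   module, which is closed before the latter is loaded. *)
Module Discriminant.
Import mpoly.

(* [D] is a polynomial in the coefficients [a_0, ..., a_n] whose value, as soon
   as [a_n != 0], is a_n^(2n-2) \prod_(i < j) (alpha_i - alpha_j)^2, where the
   [alpha_i] are the complex roots, listed with multiplicity. By the lemmas
   [discriminant_sig] and [discriminant_unique] there is exactly one such [D]. *)
Definition is_discriminant (R : rcfType) (n : nat)
    (D : {mpoly R[n.+1]}) : Prop :=
  forall (a : 'I_n.+1 -> R) (alpha : 'I_n -> R[i]),
    a ord_max != 0 ->
    \sum_(i < n.+1) (a i)%:C *: 'X^i
      = (a ord_max)%:C *: \prod_(i < n) ('X - (alpha i)%:P) ->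
    (D.@[a])%:C
      = (a ord_max)%:C ^+ (2 * n - 2)
        * \prod_(i < n) \prod_(j < n | (i < j)%N) (alpha i - alpha j) ^+ 2.

(* Existence of the discriminant polynomial. At a root [x], put b_k = a_(n-k),
   h_0 = 1 and h_k = a_n x^k + ... + a_(n-k+1) x for 0 < k < n. Writing the h_k
   in terms of the powers of [x] (Vandermonde) shows that the determinant of the
   matrix of the sums over the roots of h_i h_j is the required product, while
   [trace_entry] is an expression of these sums as polynomials in the a_k. *)
Section TraceForm.
Variable (F : fieldType).
Implicit Types (b : nat -> F).

Fixpoint horner_acc (S : comNzRingType) (b : nat -> S) (x : S) k : S :=
  if k is k'.+1 then x * horner_acc b x k' + b k else b 0%N.

Definition hbasis b (x : F) k : F := horner_acc b x k - b k.

Definition trace_entry (S : comNzRingType) (n : nat) (b : nat -> S) (i j : nat) : S :=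
  if i == 0%N then if j == 0%N then n%:R else - (b j *+ j)
  else if j == 0%N then - (b i *+ i)
  else \sum_(t < i) (b (j + t)%N * b (i - t)%N *+ (i - t)
                      - b (i - t.+1)%N * b (j + t.+1)%N *+ (j + t.+1)).

Lemma hbasis0 b x : hbasis b x 0 = 0.
Proof. by rewrite /hbasis subrr. Qed.

Lemma hbasisS b x k : hbasis b x k.+1 = x * horner_acc b x k.
Proof. by rewrite /hbasis /= addrK. Qed.

Lemma hbasisM b x i j : hbasis b x i * hbasis b x j
  = \sum_(t < i) (- (b (j + t)%N * hbasis b x (i - t))
                  + b (i - t.+1)%N * hbasis b x (j + t.+1)).
Proof.
elim: i j => [|i IHi] j; first by rewrite big_ord0 hbasis0 mul0r.
rewrite big_ord_recl /= subn0 addn0 subSS subn0 addn1.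
transitivity (hbasis b x i * hbasis b x j.+1
   + (- (b j * hbasis b x i.+1) + b i * hbasis b x j.+1)).
  by rewrite !hbasisS /hbasis; ring.
rewrite IHi addrC; congr (_ + _); apply: eq_bigr => t _.
by rewrite /bump !add1n !subSS addSn -addnS addSn -addnS.
Qed.

Lemma horner_acc_root b x n : (forall k, (n < k)%N -> b k = 0) ->
  horner_acc b x n = 0 -> forall k, (n <= k)%N -> horner_acc b x k = 0.
Proof.
move=> b0 H0; elim=> [|k IHk]; first by rewrite leqn0 => /eqP <-.
rewrite leq_eqVlt => /orP[/eqP <- //|nk] /=.
by rewrite IHk // mulr0 add0r b0.
Qed.

Fixpoint hquo b x n : {poly F} :=
  if n is n'.+1 then 'X * hquo b x n' + (horner_acc b x n')%:P else 0.

Let bP b k : {poly F} := (b k)%:P.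

Lemma hquoP b x n :
  ('X - x%:P) * hquo b x n = horner_acc (bP b) 'X n - (horner_acc b x n)%:P.
Proof.
elim: n => [|n IHn] /=; first by rewrite mulr0 subrr.
rewrite mulrDr mulrCA IHn !polyCD polyCM /bP; ring.
Qed.

Lemma coef_hquo b x n i : (i < n)%N -> (hquo b x n)`_i = horner_acc b x (n - i.+1).
Proof.
elim: n i => // n IHn [|i] ltin /=.
  by rewrite coefD coefXM coefC /= add0r subn1.
by rewrite coefD coefXM coefC /= addr0 subSS IHn.
Qed.

Lemma coef_hacc b n i : (i <= n)%N -> (horner_acc (bP b) 'X n)`_i = b (n - i)%N.
Proof.
elim: n i => [|n IHn] [|i] lein //=; rewrite ?coefD ?coefXM ?coefC //=.
  by rewrite add0r.
by rewrite addr0 IHn.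
Qed.

Lemma size_hacc b n : (size (horner_acc (bP b) 'X n) <= n.+1)%N.
Proof.
elim: n => [|n IHn] /=; first exact: size_polyC_leq1.
apply: (leq_trans (size_polyD _ _)); rewrite geq_max mulrC.
rewrite (leq_trans (size_polyMleq _ _)) ?size_polyX ?addn2 //=.
exact: leq_trans (size_polyC_leq1 _) _.
Qed.

Variables (n : nat) (b : nat -> F) (al : 'I_n -> F).
Hypothesis b_gt : forall k, (n < k)%N -> b k = 0.
Hypothesis bE : horner_acc (bP b) 'X n = b 0%N *: \prod_(i < n) ('X - (al i)%:P).

Lemma hacc_al l : horner_acc b (al l) n = 0.
Proof.
have := hquoP b (al l) n; rewrite bE (bigD1 l) //= => /(congr1 (horner^~ (al l))).
rewrite /= hornerM hornerXsubC subrr mul0r hornerD hornerN hornerC hornerZ hornerM.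
by rewrite hornerXsubC subrr mul0r mulr0 sub0r => /esym/eqP; rewrite oppr_eq0 => /eqP.
Qed.

Lemma deriv_prodX (s : seq 'I_n) : uniq s ->
  (\prod_(i <- s) ('X - (al i)%:P))^`()
  = \sum_(l <- s) \prod_(i <- s | i != l) ('X - (al i)%:P).
Proof.
elim: s => [|x s IHs] /=; first by rewrite !big_nil derivC.
move=> /andP[xs us]; rewrite !big_cons derivM derivXsubC mul1r IHs //.
rewrite eqxx /=; congr (_ + _).
  rewrite big_seq [RHS]big_seq_cond; apply: eq_bigl => i.
  by case: eqVneq => [->|]; rewrite ?andbT ?(negPf xs).
rewrite big_distrr /= big_seq [RHS]big_seq; apply: eq_bigr => l ls.
by rewrite big_cons; case: eqVneq => // xl; rewrite xl ls in xs.
Qed.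

Lemma sum_hacc k : (k < n)%N -> \sum_l horner_acc b (al l) k = b k *+ (n - k).
Proof.
move=> ltkn.
have quoE l : hquo b (al l) n = b 0%N *: \prod_(i < n | i != l) ('X - (al i)%:P).
  have nz : 'X - (al l)%:P != 0 by rewrite polyXsubC_eq0.
  apply: (mulfI nz); rewrite hquoP hacc_al subr0 bE (bigD1 l) //=.
  by rewrite scalerAr.
have : \sum_l hquo b (al l) n = (horner_acc (bP b) 'X n)^`().
  rewrite bE derivZ deriv_prodX ?index_enum_uniq // scaler_sumr.
  by apply: eq_bigr => l _; rewrite quoE.
move=> /(congr1 (fun p : {poly F} => p`_(n - k.+1))); rewrite coef_sum coef_deriv.
rewrite -subSn // subSS coef_hacc ?leq_subr // subKn ?(ltnW ltkn) // => <-.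
apply: eq_bigr => l _; rewrite coef_hquo.
  by rewrite -subSn // subSS subKn // ltnW.
by case: (n) ltkn => // m _; rewrite ltnS subSS leq_subr.
Qed.

Lemma sum_hbasis k : \sum_l hbasis b (al l) k = - (b k *+ k).
Proof.
rewrite sumrB sumr_const card_ord.
have [ltkn|lenk] := ltnP k n.
  by rewrite sum_hacc // mulrnBr ?(ltnW ltkn) // addrAC subrr add0r.
rewrite big1 => [|l _]; last exact: (horner_acc_root b_gt (hacc_al l)).
rewrite sub0r; move: lenk; rewrite leq_eqVlt => /orP[/eqP<- //|ltnk].
by rewrite b_gt // !mul0rn.
Qed.

Let h' (i : nat) (l : 'I_n) := if i == 0%N then 1 else hbasis b (al l) i.

Lemma trace_entryE i j :
  \sum_l h' i l * h' j l = trace_entry n b i j.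
Proof.
rewrite /h' /trace_entry; case: eqP => _; case: eqP => _.
- by under eq_bigr do rewrite mulr1; rewrite sumr_const card_ord.
- by under eq_bigr do rewrite mul1r; rewrite sum_hbasis.
- by under eq_bigr do rewrite mulr1; rewrite sum_hbasis.
under eq_bigr do rewrite hbasisM.
rewrite exchange_big /=; apply: eq_bigr => t _.
rewrite big_split /= sumrN -!big_distrr /= !sum_hbasis.
by rewrite !mulrN opprK !mulrnAr.
Qed.

Lemma haccE x k : horner_acc b x k = \sum_(j < k.+1) b (k - j)%N * x ^+ j.
Proof.
elim: k => [|k IHk] /=; first by rewrite big_ord1 mulr1.
rewrite big_ord_recl /= mulr1 addrC IHk big_distrr; congr (_ + _).
by apply: eq_bigr => j _; rewrite /= /bump add1n subSS exprS mulrCA.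
Qed.

Let L : 'M[F]_n := \matrix_(i, j)
  (if i == 0%N :> nat then (j == 0%N :> nat)%:R
   else if j == 0%N :> nat then 0 else if (j <= i)%N then b (i - j)%N else 0).

Lemma LV : L *m Vandermonde n (\row_l al l) = \matrix_(i, l) h' i l.
Proof.
apply/matrixP => i l; rewrite !mxE /h'.
have n0 : (0 < n)%N by apply: leq_ltn_trans (ltn_ord i).
under eq_bigr do rewrite !mxE.
case: eqP => i0.
  rewrite (bigD1 (Ordinal n0)) //= big1 ?mul1r ?addr0 // => j.
  by rewrite -val_eqE /= => /negPf ->; rewrite mul0r.
case: i i0 => -[|i] // lti _ /=; rewrite hbasisS haccE big_distrr /=.
rewrite -(big_mkord xpredT (fun j => (if j == 0%N then 0
   else if (j <= i.+1)%N then b (i.+1 - j)%N else 0) * al l ^+ j)).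
rewrite (big_cat_nat (n := i.+2)) //= [X in _ + X]big_nat_cond.
rewrite [X in _ + X]big1 ?addr0; last first.
  move=> j /andP[/andP[lj _] _]; rewrite leqNgt lj /=.
  by case: eqP; rewrite mul0r.
rewrite big_nat_recl //= mul0r add0r big_mkord; apply: eq_bigr => j _.
by rewrite ltnS -ltnS ltn_ord subSS exprS mulrCA.
Qed.

Lemma det_trace : \det (\matrix_(i < n, j < n) trace_entry n b i j)
  = b 0%N ^+ (2 * n - 2)
    * \prod_(i < n) \prod_(j < n | (i < j)%N) (al i - al j) ^+ 2.
Proof.
set W := \matrix_(i < n, l < n) h' i l.
have -> : \matrix_(i < n, j < n) trace_entry n b i j = W *m W^T.
  apply/matrixP => i j; rewrite !mxE -trace_entryE.
  by apply: eq_bigr => l _; rewrite !mxE.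
rewrite det_mulmx det_tr -expr2 /W -LV det_mulmx det_Vandermonde exprMn.
congr (_ * _); last first.
  rewrite -prodrXl; apply: eq_bigr => i _; rewrite -prodrXl.
  by apply: eq_bigr => j _; rewrite !mxE -sqrrN opprB.
rewrite det_trig; last first.
  apply/is_trig_mxP => i j ltij; rewrite mxE (leqNgt j i) ltij /=.
  by case: eqP => // i0; case: eqP => // j0; rewrite i0 j0 in ltij.
under eq_bigr do rewrite mxE leqnn subnn.
have -> : (2 * n - 2 = (n - 1) * 2)%N by rewrite mulnBl mul1n mulnC.
rewrite exprM; congr (_ ^+ _).
case: (n) => [|m]; first by rewrite big_ord0.
rewrite big_ord_recl /= mul1r subn1 /=.
by rewrite prodr_const card_ord.
Qed.

End TraceForm.

Lemma discriminant_sig (R : rcfType) (n : nat) :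
  {D : {mpoly R[n.+1]} | is_discriminant D}.
Proof.
pose bm (k : nat) : {mpoly R[n.+1]} :=
  if (k <= n)%N then 'X_(inord (n - k)) else 0.
exists (\det (\matrix_(i < n, j < n) trace_entry n bm i j)) => a al a0 aE.
pose f : {rmorphism {mpoly R[n.+1]} -> R[i]} := real_complex R \o meval a.
pose b k := f (bm k).
have bE k : (k <= n)%N -> b k = (a (inord (n - k)))%:C.
  by move=> lekn; rewrite /b /bm lekn /f /= mevalXU.
have b_gt k : (n < k)%N -> b k = 0 by rewrite /b /bm ltnNge => /negPf ->; rewrite rmorph0.
have b0 : b 0%N = (a ord_max)%:C.
  by rewrite bE // subn0; congr ((a _)%:C); apply: val_inj; rewrite /= inordK.
rewrite -[LHS]/(f _) -b0 -det_map_mx -(@det_trace _ n b al) //; last first.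
  rewrite b0 -aE; apply/polyP => i.
  have [lein|ltni] := leqP i n; last first.
    rewrite nth_default ?(leq_trans (size_hacc _ _)) //.
    rewrite coef_sum big1 // => j _; rewrite coefZ coefXn.
    by rewrite gtn_eqF ?mulr0 // (leq_trans (ltn_ord j)).
  rewrite coef_hacc // bE ?leq_subr // subKn // coef_sum.
  rewrite (bigD1 (inord i)) //= coefZ coefXn inordK // eqxx mulr1 big1 ?addr0 //.
  move=> j; rewrite -val_eqE /= inordK // => ji.
  by rewrite coefZ coefXn eq_sym (negPf ji) mulr0.
congr (\det _); apply/matrixP => i j; rewrite !mxE /trace_entry.
case: ifP => _; case: ifP => _; rewrite ?rmorph_nat ?rmorphN ?rmorphMn //.
rewrite rmorph_sum; apply: eq_bigr => t _.
by rewrite rmorphB !rmorphMn !rmorphM.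
Qed.

Lemma digits_inj (B N : nat) (f g : nat -> nat) :
  (forall i, f i < B)%N -> (forall i, g i < B)%N ->
  (\sum_(i < N) f i * B ^ i = \sum_(i < N) g i * B ^ i)%N ->
  forall i, (i < N)%N -> f i = g i.
Proof.
elim: N f g => // N IHN f g fB gB.
have shift (h : nat -> nat) :
    (\sum_(i < N.+1) h i * B ^ i = (\sum_(i < N) h i.+1 * B ^ i) * B + h 0)%N.
  rewrite big_ord_recl /= muln1 addnC big_distrl; congr (_ + _)%N.
  by apply: eq_bigr => i _; rewrite /= /bump add1n expnSr mulnA.
have B0 : (0 < B)%N by apply: leq_ltn_trans (fB 0%N).
rewrite !shift => fg; have fg0 : f 0%N = g 0%N.
  by have := congr1 (modn^~ B) fg; rewrite /= !modnMDl !modn_small.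
move: fg; rewrite fg0 => /addIn/eqP; rewrite eqn_pmul2r // => /eqP fg [//|i].
exact: IHN (fun i => fB i.+1) (fun i => gB i.+1) fg i.
Qed.

Lemma mpoly_eq0 (R : numFieldType) (n : nat) (p : {mpoly R[n.+1]}) :
  (forall a, a ord_max != 0 -> p.@[a] = 0) -> p = 0.
Proof.
move=> pE; apply/eqP; apply/negPn/negP => p0.
pose B := msize p.
pose e (m : 'X_{1..n.+1}) := (\sum_(i < n.+1) m i * B ^ i)%N.
pose q : {poly R} := \sum_(m <- msupp p) p@_m *: 'X^(e m).
have qE x : x != 0 -> q.[x] = 0.
  move=> x0; rewrite -(pE (fun i => x ^+ (B ^ i))) ?expf_neq0 // mevalE horner_sum.
  apply: eq_bigr => m _; rewrite hornerZ hornerXn /e -prodrXr; congr (_ * _).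
  by apply: eq_bigr => i _; rewrite mulnC exprM.
have q0 : q = 0.
  apply/eqP; apply/negPn/negP => qn0.
  have : (size [seq k.+1%:R : R | k <- iota 0 (size q)] < size q)%N.
    apply: max_poly_roots => //.
      by apply/allP => _ /mapP[k _ ->]; apply/rootP/qE; rewrite pnatr_eq0.
    rewrite map_inj_uniq ?iota_uniq // => k l /eqP.
    by rewrite eqr_nat eqSS => /eqP.
  by rewrite size_map size_iota ltnn.
have lead_supp := mlead_supp p0.
have := congr1 (fun r : {poly R} => r`_(e (mlead p))) q0.
rewrite coef0 coef_sum (bigD1_seq (mlead p)) ?msupp_uniq //= coefZ coefXn eqxx mulr1.
rewrite big_seq_cond big1 ?addr0 => [/eqP|m /andP[mp mneq]]; last first.
  rewrite coefZ coefXn; case: eqP => [ee|_]; last by rewrite mulr0.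
  case/eqP: mneq; apply/mnmP => i.
  have small (m' : 'X_{1..n.+1}) : m' \in msupp p -> forall k, (m' (inord k) < B)%N.
    move=> m'p k; apply: leq_ltn_trans (msize_mdeg_lt m'p).
    by rewrite mdegE (bigD1 (inord k)) //= leq_addr.
  have := @digits_inj B n.+1 (fun k => m (inord k)) (fun k => mlead p (inord k))
    (small _ mp) (small _ lead_supp) _ i (ltn_ord i).
  rewrite inord_val; apply.
  by under eq_bigr do rewrite inord_val; under [RHS]eq_bigr do rewrite inord_val.
by rewrite -/(mleadc p) mleadc_eq0 (negPf p0).
Qed.

Lemma discriminant_unique (R : rcfType) (n : nat) (D E : {mpoly R[n.+1]}) :
  is_discriminant D -> is_discriminant E -> D = E.
Proof.
move=> DP EP; apply/eqP; rewrite -subr_eq0; apply/eqP/mpoly_eq0 => a a0.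
pose p : {poly R[i]} := \sum_(i < n.+1) (a i)%:C *: 'X^i.
have pn : p`_n = (a ord_max)%:C.
  rewrite /p coef_sum (bigD1 ord_max) //= coefZ coefXn eqxx mulr1 big1 ?addr0 //.
  move=> i; rewrite -val_eqE /= => i_n.
  by rewrite coefZ coefXn eq_sym (negPf i_n) mulr0.
have a0C : (a ord_max)%:C != 0 :> R[i] by rewrite fmorph_eq0.
have szp : size p = n.+1.
  apply/eqP; rewrite eqn_leq; apply/andP; split; last first.
    by rewrite ltnNge; apply: contra a0C => /leq_sizeP/(_ n (leqnn _)); rewrite pn => ->.
  apply: (leq_trans (size_sum _ _ _)); apply/bigmax_leqP => i _.
  by rewrite (leq_trans (size_scale_leq _ _)) // size_polyXn.
have [rs pE] := closed_field_poly_normal p.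
have szrs : size rs = n.
  apply: succn_inj; rewrite -szp pE size_scale ?size_prod_XsubC //.
  by rewrite lead_coef_eq0 -size_poly_eq0 szp.
have aE : p = (a ord_max)%:C *: \prod_(i < n) ('X - (rs`_i)%:P).
  rewrite {1}pE lead_coefE szp pn; congr (_ *: _).
  by rewrite (big_nth 0) szrs big_mkord.
apply/eqP; rewrite mevalB subr_eq0; apply/eqP/complexI.
by rewrite (DP _ _ a0 aE) (EP _ _ a0 aE).
Qed.

Definition discriminant (R : rcfType) (n : nat) (a : 'I_n.+1 -> R) : R :=
  (sval (discriminant_sig R n)).@[a].

Lemma discriminantE (R : rcfType) (n : nat) (D : {mpoly R[n.+1]})
    (a : 'I_n.+1 -> R) :
  is_discriminant D -> discriminant a = D.@[a].
Proof.
move=> DP; rewrite /discriminant.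
by rewrite (discriminant_unique (svalP (discriminant_sig R n)) DP).
Qed.

Lemma discriminant_roots (R : rcfType) (n : nat) (a : 'I_n.+1 -> R)
    (alpha : 'I_n -> R[i]) :
  a ord_max != 0 ->
  \sum_(i < n.+1) (a i)%:C *: 'X^i
    = (a ord_max)%:C *: \prod_(i < n) ('X - (alpha i)%:P) ->
  (discriminant a)%:C
    = (a ord_max)%:C ^+ (2 * n - 2)
      * \prod_(i < n) \prod_(j < n | (i < j)%N) (alpha i - alpha j) ^+ 2.
Proof. exact: (svalP (discriminant_sig R n)). Qed.

End Discriminant.

Notation discriminant := Discriminant.discriminant.

From mathcomp Require Import all_classical all_reals all_analysis.

Local Close Scope complex_scope.
Local Open Scope classical_set_scope.

Definition mutually_independent (d : measure_display) (T : measurableType d)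
    (R : realType) (P : probability T R) (I : finType)
    (X : I -> {RV P >-> R}) : Prop :=
  forall (J : {set I}) (B : I -> set R), (forall i, measurable (B i)) ->
    P (\bigcap_(i in [set` J]) (X i @^-1` B i))
    = (\prod_(i in J) P (X i @^-1` B i))%E.

Definition uniform_on_interval (d : measure_display) (T : measurableType d)
    (R : realType) (P : probability T R) (X : {RV P >-> R}) (a b : R) : Prop :=
  exists ab : a < b, forall A : set R, measurable A ->
    distribution P X A = uniform_prob ab A.

(* The 2Q+1 probabilities sum to 1, so this determines the law of [X]. *)
Definition uniform_on_integers (d : measure_display) (T : measurableType d)
    (R : realType) (P : probability T R) (X : {RV P >-> R}) (Q : nat) : Prop :=
  forall k : int, - Q%:Z <= k <= Q%:Z ->
    P (X @^-1` [set k%:~R]) = ((2 * Q + 1)%:R^-1)%:E.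

Definition has_density (d : measure_display) (T : measurableType d)
    (R : realType) (P : probability T R) (Y : T -> R) (phi : R -> R) : Prop :=
  [/\ measurable_fun setT phi, forall x, 0 <= phi x &
      forall A : set R, measurable A ->
        P (Y @^-1` A) = (\int[lebesgue_measure]_(x in A) (phi x)%:E)%E].

(* Main.v *)
(* Cut [-1, 1[ into M = 2Q+1 cells. Rounding each coordinate of a uniform point of
   the cube to the point -1 + q/Q, which lies in the q-th closed cell, gives the law
   of the normalised integer coefficients; as D is homogeneous, the theorem
   compares the events a <= D <= b before and after rounding. Change one
   coordinate at a time: along it D is a polynomial of bounded degree, and the
   event can only change if this polynomial takes the value a or b in the
   cell, which happens in boundedly many cells out of M. Hence the
   discrepancy is O(1/Q), better than the O(1/log Q) claimed. To avoid Fubini,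
   each cell is cut into L finer ones, which makes the argument a count over
   finite sets, and then L tends to infinity; the law of D(G) has no atom, so
   the events converge almost surely. *)

Require Import Defs.
From mathcomp Require Import all_boot all_order all_algebra ring lra zify complex boolp.
From mathcomp Require mpoly.

Set Implicit Arguments.
Unset Strict Implicit.
Unset Printing Implicit Defensive.

Import Order.TTheory GRing.Theory Num.Theory.
Local Open Scope ring_scope.

(** * The discriminant as a sum of monomials, and its homogeneity *)

Definition monomial_sum (R : comNzRingType) (I : finType)
    (s : seq (R * {ffun I -> nat})) (x : I -> R) : R :=
  \sum_(m <- s) m.1 * \prod_i x i ^+ m.2 i.

(* The notations of [mpoly] clash with those of MathComp-Analysis, hence this
   module. *)
Module DiscriminantPolynomial.
Import mpoly.

Lemma discriminant_monomial_sum (R : rcfType) (n : nat) :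
  exists s : seq (R * {ffun 'I_n.+1 -> nat}),
    forall a, discriminant a = monomial_sum s a.
Proof.
pose D := sval (Discriminant.discriminant_sig R n).
exists [seq (D@_m, [ffun i => (m : 'X_{1..n.+1}) i]) | m <- msupp D] => a.
rewrite /discriminant /monomial_sum mevalE [RHS]big_map; apply: eq_bigr => m _ /=.
by congr (_ * _); apply: eq_bigr => i _; rewrite ffunE.
Qed.

(** Homogeneity comes from uniqueness. Scaling the coefficients by c keeps the roots and multiplies
    the leading coefficient by c, so the polynomial D(c X) / c^(2n-2), called [E] below, is again a
    discriminant and hence equals D. *)
Lemma discriminantZ (R : rcfType) (n : nat) (c : R) (a : 'I_n.+1 -> R) :
  c != 0 -> discriminant (fun i => c * a i) = c ^+ (2 * n - 2) * discriminant a.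
Proof.
move=> c0; pose D := sval (Discriminant.discriminant_sig R n).
have DP : Discriminant.is_discriminant D by exact: svalP.
have cn0 : c ^+ (2 * n - 2) != 0 by rewrite expf_neq0.
pose E := (c ^+ (2 * n - 2))^-1 *: comp_mpoly [tuple c *: ('X_i : {mpoly R[n.+1]}) | i < n.+1] D.
have EE b : E.@[b] = (c ^+ (2 * n - 2))^-1 * D.@[fun i => c * b i].
  rewrite mevalZ comp_mpoly_meval; congr (_ * _); apply: meval_eq => i.
  by rewrite tnth_mktuple mevalZ mevalXU.
have EP : Discriminant.is_discriminant E.
  move=> b al b0 bE.
  have cb0 : c * b ord_max != 0 by rewrite mulf_neq0.
  have DcbE := DP (fun i => c * b i) al cb0; rewrite EE rmorphM /= DcbE; last first.
    rewrite rmorphM /= -scalerA -bE scaler_sumr.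
    by apply: eq_bigr => i _; rewrite rmorphM /= scalerA.
  rewrite rmorphM /= fmorphV rmorphXn /= exprMn -mulrA mulKf //.
  by rewrite expf_neq0 // fmorph_eq0.
by rewrite (Discriminant.discriminantE _ DP) (Discriminant.discriminantE _ EP) EE mulVKf.
Qed.

End DiscriminantPolynomial.

Definition subst (I : eqType) (U : Type) (x : I -> U) (i : I) (y : U) : I -> U :=
  fun j => if j == i then y else x j.

Lemma monomial_sum_slice (R : comNzRingType) (I : finType)
    (s : seq (R * {ffun I -> nat})) (d : nat) (x : I -> R) (i : I) :
  (forall m, m \in s -> m.2 i <= d)%N ->
  exists2 p : {poly R}, (size p <= d.+1)%N &
    forall y, monomial_sum s (subst x i y) = p.[y].
Proof.
move=> sd; exists (\sum_(m <- s) (m.1 * \prod_(j | j != i) x j ^+ m.2 j) *: 'X^(m.2 i)).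
  rewrite big_seq; apply: (leq_trans (size_sum _ _ _)).
  apply/bigmax_leqP_seq => m ms _; rewrite (leq_trans (size_scale_leq _ _)) //.
  by rewrite size_polyXn ltnS (sd _ ms).
move=> y; rewrite horner_sum; apply: eq_bigr => m _.
rewrite hornerZ hornerXn (bigD1 i) //= /subst eqxx mulrCA mulrC; congr (_ * _ * _).
by apply: eq_bigr => j /negPf ->.
Qed.

(** * Counting the cells in which a polynomial can cross a given value *)

Section Cells.
Variables (R : rcfType) (e : nat -> R).
Hypothesis e_lt : {homo e : i j / (i < j)%N >-> i < j}.

(* Two cells whose indices have the same parity have no common point. *)
Lemma card_cells_with_root (M : nat) (p : {poly R}) (B : {set 'I_M}) :
  p != 0 ->
  (forall q, q \in B -> exists z, (e q <= z <= e q.+1) && root p z) ->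
  (#|B| <= 2 * (size p).-1)%N.
Proof.
move=> p0 Bz.
have [z zP] : exists z : 'I_M -> R, forall q, q \in B ->
    (e q <= z q <= e q.+1) && root p (z q).
  apply: (@fin_all_exists _ (fun=> R)
    (fun q z => q \in B -> (e q <= z <= e q.+1) && root p z)) => q.
  have [qB|_] := boolP (q \in B); last by exists 0.
  by have [z zq] := Bz q qB; exists z.
have half (b : bool) : (#|[set q in B | odd q == b]| <= (size p).-1)%N.
  rewrite cardE -(size_map z) -ltnS prednK ?size_poly_gt0 //.
  apply: max_poly_roots => //.
    apply/allP => _ /mapP[q + ->]; rewrite mem_enum inE => /andP[qB _].
    by case/andP: (zP q qB).
  rewrite map_inj_in_uniq ?enum_uniq // => q q'; rewrite !mem_enum !inE.
  have z_lt (i j : 'I_M) : i \in B -> j \in B -> odd i = odd j -> (i < j)%N -> z i < z j.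
    move=> iB jB odd_ij ltij.
    case/andP: (zP i iB) => /andP[_ zi] _; case/andP: (zP j jB) => /andP[zj _] _.
    apply: le_lt_trans zi _; apply: lt_le_trans zj; apply: e_lt.
    by rewrite ltn_neqAle ltij andbT; apply: contra_eq_neq odd_ij => <- /=; case: odd.
  move=> /andP[qB /eqP oq] /andP[q'B /eqP oq'] zqq'; apply: val_inj => /=.
  have oo : odd q = odd q' by rewrite oq oq'.
  case: (ltngtP q q') => // lt_qq'.
    by have := z_lt _ _ qB q'B oo lt_qq'; rewrite zqq' ltxx.
  by have := z_lt _ _ q'B qB (esym oo) lt_qq'; rewrite zqq' ltxx.
have -> : B = [set q in B | odd q == true] :|: [set q in B | odd q == false].
  by apply/setP => q; rewrite !inE; case: (q \in B); case: odd.
by rewrite (leq_trans (leq_card_setU _ _)) // mulSn mul1n leq_add.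
Qed.

(** The predicate is constant on every closed interval that avoids [cs]; at the points of [cs]
    themselves either value is allowed. For a <= x <= b the switching points are the finite
    endpoints. *)
Definition switches_at (A : pred R) (cs : seq R) : Prop :=
  forall x y, A x != A y -> exists2 c, c \in cs & Num.min x y <= c <= Num.max x y.

Lemma poly_ivt_minmax (p : {poly R}) (x y c lo hi : R) :
  lo <= x <= hi -> lo <= y <= hi ->
  Num.min p.[x] p.[y] <= c <= Num.max p.[x] p.[y] ->
  exists z, (lo <= z <= hi) && root (p - c%:P) z.
Proof.
wlog lexy : x y / x <= y => [wl|].
  have [/wl//|/ltW leyx xb yb] := leP x y.
  by rewrite minC maxC; apply: wl.
(* Passing to [- p] and [- c] exchanges minimum and maximum and keeps the roots of p - c. *)
wlog lepxy : p c / p.[x] <= p.[y] => [wl xb yb cb|].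
  have [/wl|/ltW lepyx] := leP p.[x] p.[y]; first exact.
  have [||z] := wl (- p) (- c) _ xb yb; rewrite ?hornerN ?lerN2 //.
    by rewrite -oppr_max -oppr_min !lerN2 andbC.
  move=> /andP[zb]; rewrite polyCN -opprD rootN => zr; exists z.
  by rewrite zb zr.
move=> /andP[lox xhi] /andP[loy yhi]; rewrite min_l // max_r // => /andP[pxc cpy].
have [|z /andP[xz zy] zr] := @poly_ivt _ (p - c%:P) x y lexy.
  by rewrite !hornerE subr_le0 subr_ge0 pxc.
by exists z; rewrite (le_trans lox xz) (le_trans zy yhi).
Qed.

(** Both sample points lie in the closed coarse cell [k.1]. If the predicate differs between the
    values of p there, some c in [cs] lies between these values, and p - c has a root in that cell.
    For each c this concerns at most 2d coarse cells, each holding L fine ones. *)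
Lemma card_switch_cells (M L d : nat) (u : 'I_M -> R) (v : 'I_M * 'I_L -> R)
    (A : pred R) (cs : seq R) (p : {poly R}) :
  (forall q : 'I_M, e q <= u q <= e q.+1) ->
  (forall k : 'I_M * 'I_L, e k.1 <= v k <= e k.1.+1) ->
  switches_at A cs -> (size p <= d.+1)%N ->
  (#|[set k | A p.[v k] != A p.[u k.1]]| <= size cs * (2 * d * L))%N.
Proof.
move=> uE vE AP szp.
pose W c := [set k | (A p.[v k] != A p.[u k.1]) &&
  (Num.min p.[v k] p.[u k.1] <= c <= Num.max p.[v k] p.[u k.1])].
have cardW c : (#|W c| <= 2 * d * L)%N.
  (* If p is the constant c, both values agree and no cell is bad; otherwise p - c is nonzero and
     its roots can be counted. *)
  have [pc|pc] := eqVneq (p - c%:P) 0.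
    rewrite (_ : W c = set0) ?cards0 //; apply/setP => k; rewrite !inE.
    by move/eqP: pc; rewrite subr_eq0 => /eqP->; rewrite !hornerC eqxx.
  have sub : W c \subset setX (fst @: W c) setT.
    by apply/subsetP => k kW; rewrite !inE andbT imset_f.
  apply: (leq_trans (subset_leq_card sub)); rewrite cardsX cardsT card_ord.
  rewrite leq_mul2r; apply/orP; right.
  apply: leq_trans (_ : 2 * (size (p - c%:P)%R).-1 <= _)%N.
    apply: card_cells_with_root => // _ /imsetP[k + ->]; rewrite inE => /andP[_ cb].
    exact: poly_ivt_minmax cb.
  rewrite leq_mul2l /= -ltnS prednK ?size_poly_gt0 //.
  by rewrite (leq_trans (size_polyD _ _)) // geq_max szp size_polyN
             (leq_trans (size_polyC_leq1 _)).
apply: (@leq_trans #|\bigcup_(c <- cs) W c|).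
  apply/subset_leq_card/subsetP => k; rewrite inE => kA.
  have [c ccs cb] := AP _ _ kA; rewrite big_tnth; apply/bigcupP.
  exists (Ordinal (etrans (index_mem c cs) ccs)) => //.
  by rewrite inE kA (tnth_nth 0) /= nth_index.
elim: cs {AP} => [|c cs IHcs]; first by rewrite big_nil cards0.
by rewrite big_cons (leq_trans (leq_card_setU _ _)) // mulSn leq_add.
Qed.

End Cells.

(** * Exchanging the coordinates one after the other *)

Section Hybrid.
Variables (N : nat) (K : finType) (U : Type).
Implicit Types (k : {ffun 'I_N -> K}) (g : ('I_N -> U) -> bool).

Definition ffun_subst k (i : 'I_N) (x : K) : {ffun 'I_N -> K} := finfun (subst k i x).

(** Swapping x with the i-th value of k is an involution on the pairs (k, x), so overwriting one
    coordinate in all possible ways reaches each function exactly [#|K|] times. *)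
Lemma sum_ffun_subst (F : {ffun 'I_N -> K} -> nat) (i : 'I_N) :
  (\sum_k \sum_x F (ffun_subst k i x) = (\sum_k F k) * #|K|)%N.
Proof.
pose h (z : {ffun 'I_N -> K} * K) := (ffun_subst z.1 i z.2, z.1 i).
have hK : involutive h.
  move=> [k x]; rewrite /h /=; congr (_, _); last by rewrite ffunE /subst eqxx.
  by apply/ffunP => j; rewrite !ffunE /subst !ffunE /subst; case: eqP => // ->.
rewrite pair_big /= (reindex_inj (inv_inj hK)) /=.
under eq_bigr => z _ do rewrite -[ffun_subst _ _ _]/((h (h z)).1) hK.
rewrite -(pair_big xpredT xpredT (fun k x => F k)) /= big_distrl /=.
by apply: eq_bigr => k _; rewrite sum_nat_const mulnC.
Qed.

(* Replaces the coordinates [v (k i)] by [u (k i)] one at a time. *)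
Lemma card_hybrid (u v : K -> U) g (B : nat) :
  (forall i x,
     #|[set y | g (subst x i (v y)) != g (subst x i (u y))]| <= B)%N ->
  (#|[set k : {ffun 'I_N -> K} | g (v \o k) != g (u \o k)]| * #|K| <= N * B * #|K| ^ N)%N.
Proof.
move=> gB.
pose mix s k (i : 'I_N) := if (i < s)%N then u (k i) else v (k i).
pose W (s : 'I_N) := [set k : {ffun 'I_N -> K} | g (mix s k) != g (mix s.+1 k)].
(* Average over the s-th coordinate: with the others fixed, the two mixtures differ only there, and
   at most B of its values are bad by hypothesis. *)
have cardW s : (#|W s| * #|K| <= B * #|K| ^ N)%N.
  rewrite -sum1_card big_mkcond /= -(sum_ffun_subst _ s).
  rewrite -[X in (_ ^ X)%N](card_ord N) -card_ffun mulnC -sum_nat_const.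
  apply: leq_sum => k _; rewrite -big_mkcond sum1dep_card.
  apply: leq_trans (gB s (mix s k)); apply/subset_leq_card/subsetP => y.
  rewrite !inE; congr (g _ != g _); apply/funext => i;
    rewrite /mix /subst ffunE /subst; case: eqP => [->|/eqP].
  - by rewrite ltnn.
  - by [].
  - by rewrite ltnSn.
  - by rewrite -val_eqE ltnS leq_eqVlt => /negPf ->.
apply: (@leq_trans ((\sum_s #|W s|) * #|K|)); last first.
  rewrite big_distrl /= -mulnA -[X in (X * _)%N](card_ord N) -sum_nat_const.
  exact: leq_sum.
rewrite leq_mul2r; apply/orP; right.
(* If no single exchange changes g, induction on the number of exchanged coordinates shows that the
   full exchange does not either. *)
apply: (@leq_trans #|\bigcup_s W s|).
  apply/subset_leq_card/subsetP => k; rewrite inE => gk; apply/bigcupP/exists_inP.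
  apply: contraR gk; rewrite negb_exists => /forallP gk.
  have -> : v \o k = mix 0 k by [].
  have -> : u \o k = mix N k by apply/funext => i; rewrite /mix ltn_ord.
  elim: {-2}N (leqnn N) => [//|s IHs] ltsN.
  rewrite (eqP (IHs (ltnW ltsN))).
  by have := gk (Ordinal ltsN); rewrite inE negbK.
elim/big_rec2: _ => [|s m S _ leS]; first by rewrite cards0.
by rewrite (leq_trans (leq_card_setU _ _)) // leq_add2l.
Qed.

End Hybrid.

From mathcomp Require Import all_classical all_reals all_analysis measurable_realfun.

Import numFieldNormedType.Exports.
Local Open Scope classical_set_scope.
Local Open Scope ring_scope.

(** * Probabilities of events decided by the cells of the coordinates *)

Section CellProbability.
Context (d : measure_display) (T : measurableType d) (R : realType)
  (P : probability T R) (I K : finType) (X : I -> {RV P >-> R}) (B : K -> set R).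
Hypotheses (X_indep : mutually_independent X) (mB : forall k, measurable (B k))
  (tB : trivIset setT B) (K0 : (0 < #|K|)%N)
  (PB : forall i k, P (X i @^-1` B k) = (#|K|%:R^-1)%:E).

(** The index set is a full [{set I}], the form in which [mutually_independent] factors the
    probability. *)
Definition cylinder (k : {ffun I -> K}) : set T :=
  \bigcap_(i in [set` [set: I]%SET]) (X i @^-1` B (k i)).

Lemma cylinderP k t : cylinder k t <-> forall i, B (k i) (X i t).
Proof.
split=> [kt i|kt i _]; last exact: kt.
by apply: (kt i); rewrite /= finset.in_setT.
Qed.

Lemma measurable_cylinder k : measurable (cylinder k).
Proof.
apply: fin_bigcap_measurable => // i _.
rewrite -[X in measurable X]setTI; exact: measurable_funP.
Qed.

Lemma prob_cylinder k : P (cylinder k) = (#|K|%:R ^- #|I|)%:E.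
Proof.
rewrite (X_indep _ (B := fun i => B (k i))) => [|i]; last exact: mB.
under eq_bigr do rewrite PB.
rewrite prodEFin; congr (_%:E).
by rewrite prodr_const finset.cardsT exprVn.
Qed.

Lemma prob_bigcup_cylinder (phi : pred {ffun I -> K}) :
  P (\bigcup_(k in [set` phi]) cylinder k) = (#|phi|%:R / #|K|%:R ^+ #|I|)%:E.
Proof.
rewrite measure_fin_bigcup //; last 1 first.
- by move=> k _; exact: measurable_cylinder.
- rewrite (_ : [set` phi] = [set` enum phi]); last first.
    by apply/seteqP; split=> k /=; rewrite mem_enum.
  rewrite -fsbig_seq ?enum_uniq //.
  rewrite (eq_bigr (fun=> (#|K|%:R ^- #|I|)%:E)) => [|k _]; last exact: prob_cylinder.
  rewrite sumEFin big_enum /=.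
  by rewrite sumr_const mulr_natl.
- move=> k k' _ _ [t [/cylinderP kt /cylinderP k't]]; apply/ffunP => i.
  by apply: (tB (i := k i) (j := k' i)) => //; exists (X i t).
Qed.

Lemma bigcup_cylinder_measurable (phi : pred {ffun I -> K}) :
  measurable (\bigcup_(k in [set` phi]) cylinder k).
Proof. by apply: fin_bigcup_measurable => // k _; exact: measurable_cylinder. Qed.

(** All cylinders have the same mass, and these masses add up to 1, so the probability is a
    proportion of index functions. With intervals as cells this serves the uniform variables, with
    singletons the integer ones. *)
Lemma prob_cells (S : set T) (phi : pred {ffun I -> K}) : measurable S ->
  (forall (k : {ffun I -> K}) t, (forall i, B (k i) (X i t)) -> S t <-> phi k) ->
  P S = (#|phi|%:R / #|K|%:R ^+ #|I|)%:E.
Proof.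
move=> mS Sphi.
have KI0 : (#|K|%:R ^+ #|I| != 0 :> R) by rewrite expf_neq0 // pnatr_eq0 -lt0n.
apply/eqP; rewrite eq_le; apply/andP; split; last first.
  rewrite -prob_bigcup_cylinder; apply: le_measure; rewrite ?inE //.
    exact: bigcup_cylinder_measurable.
  by move=> t [k phik /cylinderP /Sphi ->].
(* The cells need not cover the line, so the upper bound comes from the
   cylinders contained in the complement of [S]. *)
have -> : (#|phi|%:R / #|K|%:R ^+ #|I|)%:E
    = (1 - P (\bigcup_(k in [set` predC phi]) cylinder k))%E.
  rewrite prob_bigcup_cylinder -EFinB; congr (_%:E).
  apply: (mulIf KI0); rewrite mulrBl !divfK // mul1r -natrX -card_ffun.
  by rewrite -(cardC phi) natrD addrK.
rewrite -probability_setC; last exact: bigcup_cylinder_measurable.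
apply: le_measure; rewrite ?inE //; first exact/measurableC/bigcup_cylinder_measurable.
move=> t St [k /= /negP phik /cylinderP kt]; apply: phik.
exact/(Sphi _ _ kt).
Qed.

End CellProbability.

(** * The grid on the interval from -1 to 1, and step functions *)

Section Grid.
Variable R : realType.

Definition grid (m j : nat) : R := -1 + 2 * (j%:R / m%:R).

Definition cell (m j : nat) : set R := `[grid m j, grid m j.+1[.

Lemma grid_lt m : (0 < m)%N -> {homo grid m : i j / (i < j)%N >-> i < j}.
Proof.
move=> m0 i j ij; rewrite /grid ltrD2l ltr_pM2l // ltr_pM2r ?ltr_nat //.
by rewrite invr_gt0 ltr0n.
Qed.

Lemma grid_le m : (0 < m)%N -> {homo grid m : i j / (i <= j)%N >-> i <= j}.
Proof.
move=> m0 i j; rewrite leq_eqVlt => /orP[/eqP-> //|ij].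
exact/ltW/grid_lt.
Qed.

Lemma gridM m l j : (0 < l)%N -> grid (m * l) (j * l) = grid m j.
Proof.
move=> l0; rewrite /grid !natrM invfM mulrACA divff ?mulr1 //.
by rewrite pnatr_eq0 -lt0n.
Qed.

Lemma grid_itv m j : (0 < m)%N -> (j <= m)%N -> -1 <= grid m j <= 1.
Proof.
move=> m0 jm; have g0 : grid m 0 = -1 by rewrite /grid mul0r mulr0 addr0.
have gm : grid m m = 1 by rewrite /grid divff ?pnatr_eq0 -?lt0n //; lra.
by rewrite -[X in X <= _ <= _]g0 -[X in _ <= _ <= X]gm !grid_le.
Qed.

Lemma trivIset_cell m : (0 < m)%N -> trivIset setT (cell m).
Proof.
move=> m0 i j _ _ [x []]; rewrite /cell /= !in_itv /= => /andP[ix xi] /andP[jx xj].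
by case: (ltngtP i j) => // /(grid_le m0) ij; exfalso; lra.
Qed.

Lemma cell_cover m x : (0 < m)%N -> -1 <= x < 1 -> exists2 j, (j < m)%N & cell m j x.
Proof.
move=> m0 /andP[x1 x2]; have m0R : (0 : R) < m%:R by rewrite ltr0n.
(* The distance from -1 to x in units of the cell width 2/m; its integer part is the index of the
   cell. *)
pose y := (x + 1) / 2 * m%:R.
have xE : x = -1 + 2 * (y / m%:R) by rewrite /y mulfK ?gt_eqF //; lra.
have y0 : 0 <= y by rewrite /y mulr_ge0 //; lra.
have /andP[y1 y2] := truncn_itv y0.
exists (Num.truncn y).
  rewrite -(ltr_nat R); apply: le_lt_trans y1 _.
  by rewrite -[ltRHS]mul1r /y ltr_pM2r //; lra.
rewrite /cell /= in_itv /= xE /grid lerD2l ltrD2l ler_pM2l // ltr_pM2l //.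
by rewrite ler_pM2r ?ltr_pM2r ?invr_gt0 // y1.
Qed.

Lemma cell_refine m l q r : (0 < m)%N -> (r < l)%N ->
  cell (m * l) (q * l + r) `<=` cell m q.
Proof.
move=> m0 rl; have l0 : (0 < l)%N by case: (l) rl.
have ml0 : (0 < m * l)%N by rewrite muln_gt0 m0.
move=> x; rewrite /cell /= !in_itv /= => /andP[x1 x2]; apply/andP; split.
  by apply: le_trans x1; rewrite -(gridM m q l0) grid_le // leq_addr.
by apply: lt_le_trans x2 _; rewrite -(gridM m q.+1 l0) grid_le // mulSnr -addnS leq_add2l.
Qed.

Lemma prob_uniform_itvco (d : measure_display) (T : measurableType d)
    (P : probability T R) (X : {RV P >-> R}) (l h : R) :
  uniform_on_interval X (-1) 1 -> -1 <= l -> l <= h -> h <= 1 ->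
  P (X @^-1` `[l, h[) = ((h - l) / 2)%:E.
Proof.
move=> [ab XP] l1 lh h1.
rewrite -[LHS]/(distribution P X _) XP // /uniform_prob.
rewrite (eq_integral (fun=> (2^-1)%:E)) => [|x]; last first.
  rewrite inE /= in_itv /= /uniform_pdf => /andP[lx xh].
  by rewrite (le_trans l1 lx) (le_trans (ltW xh) h1) opprK -natr1.
rewrite integral_cst //= lebesgue_measure_itv /= lte_fin.
case: ltP => [_|hl]; first by rewrite -EFinB -EFinM mulrC.
by have -> : h = l; [lra|rewrite subrr mul0r mule0].
Qed.

Lemma prob_cell (d : measure_display) (T : measurableType d)
    (P : probability T R) (X : {RV P >-> R}) (m j : nat) :
  uniform_on_interval X (-1) 1 -> (j < m)%N ->
  P (X @^-1` cell m j) = (m%:R^-1)%:E.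
Proof.
move=> XU jm; have m0 : (0 < m)%N by apply: leq_ltn_trans jm.
have /andP[lj _] := grid_itv m0 (ltnW jm); have /andP[_ jh] := grid_itv m0 jm.
rewrite prob_uniform_itvco ?grid_le //; congr (_%:E).
by rewrite /grid -[j.+1%:R]natr1 [(j%:R + 1) / _]mulrDl mul1r; lra.
Qed.

Section Step.
Variables (K : finType) (B : K -> set R) (v : K -> R).

(** A sum of indicators is visibly measurable; off all the cells it takes the value 0. *)
Definition step (x : R) : R := \sum_k v k * \1_(B k) x.

Lemma stepE k x : trivIset setT B -> B k x -> step x = v k.
Proof.
move=> tB kx; rewrite /step (bigD1 k) //= big1 ?addr0 => [|k' k'k].
  by rewrite indicE mem_set ?mulr1.
rewrite indicE memNset ?mulr0 // => k'x; case/eqP: k'k.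
by apply: tB => //; exists x.
Qed.

Lemma measurable_step : (forall k, measurable (B k)) -> measurable_fun setT step.
Proof.
by move=> mB; apply: measurable_sum => k; exact: measurable_funM.
Qed.

End Step.
End Grid.

(** * Measurability, limits and negligible sets *)

Lemma measurable_monomial_sum (d : measure_display) (T : measurableType d)
    (R : realType) (I : finType) (s : seq (R * {ffun I -> nat})) (X : I -> T -> R) :
  (forall i, measurable_fun setT (X i)) ->
  measurable_fun setT (fun t => monomial_sum s (X ^~ t)).
Proof.
move=> mX; apply: measurable_sum => m; apply: measurable_funM => //.
by apply: measurable_prod => i _; exact: measurable_funX.
Qed.

Lemma cvg_monomial_sum (R : realType) (I : finType) (s : seq (R * {ffun I -> nat}))
    (y : nat -> I -> R) (x : I -> R) :
  (forall i, y ^~ i @ \oo --> x i) ->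
  (fun l => monomial_sum s (y l)) @ \oo --> monomial_sum s x.
Proof.
move=> yx; rewrite /monomial_sum; elim: s => [|m s IHs].
  by under eq_fun do rewrite big_nil; rewrite big_nil; exact: cvg_cst.
under eq_fun do rewrite big_cons; rewrite big_cons; apply: cvgD => //.
apply: cvgM; first exact: cvg_cst.
elim: (index_enum I) => [|i r IHr].
  by under eq_fun do rewrite big_nil; rewrite big_nil; exact: cvg_cst.
under eq_fun do rewrite big_cons; rewrite big_cons; apply: cvgM => //.
exact: (cvg_comp _ _ (yx i) (@exprn_continuous _ _ _)).
Qed.

Lemma negligible_bigcup_seq (d : measure_display) (T : measurableType d)
    (R : realType) (mu : {measure set T -> \bar R}) (I : choiceType) (r : seq I)
    (F : I -> set T) :
  (forall i, i \in r -> mu.-negligible (F i)) ->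
  mu.-negligible (\bigcup_(i in [set` r]) F i).
Proof.
elim: r => [_|i r IHr rF]; first by rewrite set_nil bigcup_set0; exact: negligible_set0.
rewrite bigcup_seq big_cons -bigcup_seq; apply: negligibleU; first exact/rF/mem_head.
by apply: IHr => j jr; apply: rF; rewrite inE jr orbT.
Qed.

Lemma measurable_disagree (d : measure_display) (T : measurableType d) (a b : pred T) :
  measurable [set t | a t] -> measurable [set t | b t] ->
  measurable [set t | a t != b t].
Proof.
move=> ma mb; rewrite (_ : [set t | a t != b t] =
    ([set t | a t] `\` [set t | b t]) `|` ([set t | b t] `\` [set t | a t])).
  by apply: measurableU; exact: measurableD.
apply/seteqP; split=> t /=; case: (a t); case: (b t) => //=; try by left.
- by right.
- by case=> [[]|[]].
- by case=> [[]|[]].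
Qed.

(** The limit x has positive distance to each of the finitely many switching points. Once [y l] is
    closer to x than all of them, none lies between the two. *)
Lemma near_switches_at (R : realType) (A : pred R) (cs : seq R) (y : nat -> R) (x : R) :
  switches_at A cs -> x \notin cs -> y @ \oo --> x ->
  \forall l \near \oo, A (y l) = A x.
Proof.
move=> AP xcs yx.
have : \forall l \near \oo, forall c, c \in cs -> `|x - y l| < `|x - c|.
  elim: cs xcs {AP} => [_|c cs IHcs]; first exact: nearW.
  rewrite inE negb_or => /andP[xc /IHcs {}IHcs].
  have xc0 : 0 < `|x - c| by rewrite normr_gt0 subr_eq0.
  have yc : \forall l \near \oo, `|x - y l| < `|x - c|.
    by move/cvgrPdist_lt: yx; apply.
  near=> l; move=> c'; rewrite inE => /orP[/eqP->|]; first by near: l.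
  by move: c'; near: l.
apply: filterS => l ycs; apply/eqP/negPn/negP => /AP[c /ycs ylt /andP[lo hi]].
move: ylt; rewrite ltNge => /negP; apply.
case: (leP (y l) x) lo hi => [yx' yc cx|xy' xc cy].
  by rewrite !ger0_norm ?subr_ge0 // lerB.
by rewrite !ler0_norm ?subr_le0 ?(ltW xy') // !opprB lerB.
Unshelve. all: by end_near.
Qed.

(** * Comparing an event before and after rounding the coordinates *)

Section Coupling.
Context (d : measure_display) (T : measurableType d) (R : realType)
  (P : probability T R) (N : nat) (X : 'I_N -> {RV P >-> R}).
Hypotheses (X_indep : mutually_independent X)
  (XU : forall i, uniform_on_interval (X i) (-1) 1).
Variables (s : seq (R * {ffun 'I_N -> nat})) (D : nat).
Hypothesis sD : forall m i, m \in s -> (m.2 i <= D)%N.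
Variables (A : pred R) (cs : seq R).
Hypotheses (A_switch : switches_at A cs) (mA : measurable [set x | A x]).
Variables (M : nat) (u : 'I_M -> R).
Hypotheses (M0 : (0 < M)%N)
  (uE : forall q : 'I_M, grid R M q <= u q <= grid R M q.+1).

Definition fine_index (L : nat) (k : 'I_M * 'I_L) : nat := (k.1 * L + k.2)%N.

Definition coarse : R -> R := step (fun q : 'I_M => @cell R M q) u.

(** Rounding down to the finer grid tends to the identity as L grows, yet depends only on the fine
    cell, so its comparison with [coarse] is a finite count. *)
Definition fine_grid (L : nat) : R -> R :=
  step (fun k : 'I_M * 'I_L => @cell R (M * L) (fine_index k))
       (fun k => grid R (M * L) (fine_index k)).

Definition event_after (g : R -> R) (t : T) : bool :=
  A (monomial_sum s (fun i => g (X i t))).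

Lemma fine_index_lt L (k : 'I_M * 'I_L) : (fine_index k < M * L)%N.
Proof.
rewrite /fine_index; apply: (@leq_trans (k.1.+1 * L)); last by rewrite leq_mul2r ltn_ord orbT.
by rewrite mulSnr ltn_add2l.
Qed.

Lemma fine_index_inj L : injective (@fine_index L).
Proof.
move=> [q r] [q' r']; rewrite /fine_index /= => qr.
have L0 : (0 < L)%N by apply: leq_ltn_trans (ltn_ord r).
congr (_, _); apply: val_inj => /=.
  by have := congr1 (divn^~ L) qr; rewrite /= !divnMDl // !divn_small ?addn0.
by have := congr1 (modn^~ L) qr; rewrite /= !modnMDl !modn_small.
Qed.

Lemma trivIset_coarse : trivIset setT (fun q : 'I_M => @cell R M q).
Proof.
move=> q q' _ _ qq'; apply: val_inj => /=.
exact: (@trivIset_cell R M M0 q q' I I qq').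
Qed.

Lemma trivIset_fine L : trivIset setT (fun k : 'I_M * 'I_L => @cell R (M * L) (fine_index k)).
Proof.
move=> k k' _ _ kk'; apply: (@fine_index_inj L).
have ML0 : (0 < M * L)%N by apply: leq_ltn_trans (fine_index_lt k).
exact: (@trivIset_cell R (M * L) ML0 _ _ I I kk').
Qed.

Lemma event_afterE (g : R -> R) (t : T) (y : 'I_N -> R) :
  (forall i, g (X i t) = y i) -> event_after g t = A (monomial_sum s y).
Proof. by move=> gy; rewrite /event_after (funext gy). Qed.

Lemma measurable_event_after (g : R -> R) :
  measurable_fun setT g -> measurable [set t | event_after g t].
Proof.
move=> mg; rewrite (_ : [set t | _] =
  (fun t => monomial_sum s (fun i => g (X i t))) @^-1` [set x | A x]) //.
rewrite -[X in measurable X]setTI.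
have := @measurable_monomial_sum _ T R _ s (fun i => g \o X i); apply=> // i.
exact: measurableT_comp.
Qed.

Lemma measurable_coarse : measurable_fun setT coarse.
Proof. by apply: measurable_step => q; exact: measurable_itv. Qed.

Lemma measurable_fine_grid L : measurable_fun setT (fine_grid L).
Proof. by apply: measurable_step => q; exact: measurable_itv. Qed.

(** The fine cells decide this event. Along one coordinate the sum is a polynomial of degree at most
    D, so [card_switch_cells] bounds the bad values of that coordinate and [card_hybrid] the bad
    index functions. The factor L cancels, so the bound is uniform in L. *)
Lemma prob_coarse_fine (L : nat) : (0 < L)%N ->
  (P [set t | event_after (fine_grid L) t != event_after coarse t]
   <= ((N * (size cs * (2 * D)))%:R / M%:R)%:E)%E.
Proof.
move=> L0; have ML0 : (0 < M * L)%N by rewrite muln_gt0 M0.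
pose K : finType := ('I_M * 'I_L)%type.
have cardK : #|K| = (M * L)%N by rewrite card_prod !card_ord.
pose v (k : K) : R := grid R (M * L) (fine_index k).
pose f := monomial_sum s.
pose phi (k : {ffun 'I_N -> K}) : bool :=
  A (f (v \o k)) != A (f ((u \o fst) \o k)).
rewrite (@prob_cells _ T R P _ K X (fun k => @cell R (M * L) (fine_index k))
   X_indep _ (@trivIset_fine L) _ _ _ phi); first last.
- move=> k t kX; rewrite /phi /=.
  rewrite (@event_afterE _ t (v \o k)) => [|i]; last first.
    by rewrite /fine_grid (stepE _ (k := k i)) //; exact: trivIset_fine.
  rewrite (@event_afterE _ t ((u \o fst) \o k)) // => i.
  rewrite /coarse (stepE u (k := (k i).1)) //; first exact: trivIset_coarse.
  by apply: cell_refine (kX i).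
- by apply: measurable_disagree; apply: measurable_event_after;
    [exact: measurable_fine_grid|exact: measurable_coarse].
- by move=> i k; rewrite cardK prob_cell // fine_index_lt.
- by rewrite cardK.
- by move=> k; exact: measurable_itv.
rewrite lee_fin cardK card_ord.
have : (#|phi| * (M * L) <= N * (size cs * (2 * D * L)) * (M * L) ^ N)%N.
  have := @card_hybrid N K R (u \o fst) v (A \o f) (size cs * (2 * D * L)).
  rewrite cardK => hyb; rewrite -[#|phi|]finset.cardsE.
  apply: hyb => i x.
  have [p szp pE] := monomial_sum_slice x (fun m => @sD m i).
  rewrite (_ : finset _ = [set k : K | A p.[v k] != A p.[u k.1]]%SET); last first.
    by apply/finset.setP => k; rewrite !finset.inE /= /f !pE.
  apply: (@card_switch_cells R (grid R M) (grid_lt R M0) M L D u v) => // k.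
  rewrite -(gridM R M k.1 L0) -(gridM R M k.1.+1 L0) /v /fine_index.
  by rewrite !grid_le ?leq_addr // mulSnr leq_add2l ltnW.
have -> : (N * (size cs * (2 * D * L)) = N * (size cs * (2 * D)) * L)%N.
  by rewrite !mulnA.
rewrite -(ler_nat R) => phi_le.
have ML0R : (0 : R) < (M * L)%:R by rewrite ltr0n.
rewrite ler_pdivrMr ?exprn_gt0 // -(ler_pM2r ML0R) -natrM.
apply: le_trans phi_le _; rewrite le_eqVlt; apply/orP; left; apply/eqP.
have M0R : M%:R != 0 :> R by rewrite pnatr_eq0 -lt0n.
by rewrite natrM [in LHS]natrM natrX [in RHS]natrM; field.
Qed.

Definition disagreement : set T := [set t | event_after coarse t != event_after id t].

Lemma measurable_disagreement : measurable disagreement.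
Proof.
apply: measurable_disagree; apply: measurable_event_after => //.
exact: measurable_coarse.
Qed.

Lemma fine_grid_close (L : nat) (x : R) : (0 < L)%N -> -1 <= x < 1 ->
  x - 2 * L%:R^-1 <= fine_grid L x <= x.
Proof.
move=> L0 xE; have ML0 : (0 < M * L)%N by rewrite muln_gt0 M0.
have [j jML jx] := cell_cover ML0 xE.
have jL : (j %/ L < M)%N by rewrite ltn_divLR.
pose k : 'I_M * 'I_L := (Ordinal jL, Ordinal (ltn_pmod j L0)).
have kj : fine_index k = j by rewrite /fine_index /= -divn_eq.
rewrite /fine_grid (stepE _ (k := k)) ?kj //; last exact: trivIset_fine.
move: jx; rewrite /cell /= in_itv /= => /andP[-> xj]; rewrite andbT.
rewrite lerBlDr; apply: (le_trans (ltW xj)).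
rewrite /grid -[j.+1%:R]natr1 [(j%:R + 1) / _]mulrDl mul1r mulrDr addrA lerD2l.
rewrite ler_pM2l // lef_pV2 ?posrE ?ltr0n // ler_nat.
by rewrite leq_pmull.
Qed.

Lemma cvg_fine_grid (x : R) : -1 <= x < 1 ->
  (fun L => fine_grid L.+1 x) @ \oo --> x.
Proof.
move=> xE; apply: (@squeeze_cvgr _ _ _ _ (fun L => x - 2 * harmonic L) (cst x)).
- by apply: nearW => L; exact: fine_grid_close.
- rewrite -[X in _ --> X]subr0; apply: cvgB; first exact: cvg_cst.
  rewrite -[X in _ --> X](mulr0 2); apply: cvgM; first exact: cvg_cst.
  exact: cvg_harmonic.
- exact: cvg_cst.
Qed.

Hypothesis no_atom :
  forall c, c \in cs -> P [set t | monomial_sum s (X ^~ t) = c] = 0%E.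

(** Almost every point of [disagreement] also disagrees for all sufficiently fine grids, so the
    uniform bound passes to the limit. *)
Lemma prob_disagreement :
  (P disagreement <= ((N * (size cs * (2 * D)))%:R / M%:R)%:E)%E.
Proof.
pose E (L : nat) := [set t | event_after (fine_grid L.+1) t != event_after coarse t].
(* These sets increase with m and their union is the lower limit of the sets [E L]; continuity from
   below carries the bound over to it. *)
pose F (m : nat) := \bigcap_(L in [set L | (m <= L)%N]) E L.
have mE L : measurable (E L).
  by apply: measurable_disagree; apply: measurable_event_after;
    [exact: measurable_fine_grid|exact: measurable_coarse].
have mF m : measurable (F m) by apply: bigcap_measurableType => L _; exact: mE.
have PF m : (P (F m) <= ((N * (size cs * (2 * D)))%:R / M%:R)%:E)%E.
  apply: le_trans (prob_coarse_fine (ltn0Sn m)); apply: le_measure; rewrite ?inE //.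
    exact: mE.
  by move=> t Ft; exact: (Ft m (leqnn m)).
have PUF : (P (\bigcup_m F m) <= ((N * (size cs * (2 * D)))%:R / M%:R)%:E)%E.
  have ndF : nondecreasing_seq F.
    move=> m m' mm'; apply/subsetPset => t Ft L m'L; apply: Ft.
    exact: leq_trans m'L.
  have := nondecreasing_cvg_mu (mu := P) mF (bigcupT_measurable _ mF) ndF.
  move=> PFcvg; rewrite -(cvg_lim _ PFcvg) //; apply: lime_le.
    by apply/cvg_ex; eexists; exact: PFcvg.
  by apply: nearW => m; exact: PF.
(* Two exceptional sets: a coordinate falls outside all cells, or the unrounded value is itself a
   switching point. *)
pose N1 := \bigcup_(i in [set` enum 'I_N]) (X i @^-1` (~` `[-1, 1[)).
pose N2 := \bigcup_(c in [set` cs]) [set t | monomial_sum s (X ^~ t) = c].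
have nN1 : P.-negligible N1.
  apply: negligible_bigcup_seq => i _.
  have mXi : measurable (X i @^-1` `[-1, 1[).
    by rewrite -[X in measurable X]setTI; exact: measurable_funP.
  have PXi : P (~` (X i @^-1` `[-1, 1[)) = 0%E.
    rewrite probability_setC // prob_uniform_itvco //.
    have -> : (1 - -1) / 2 = 1 :> R by lra.
    by rewrite -EFinB subrr.
  by exists (~` (X i @^-1` `[-1, 1[)); split => //; exact: measurableC.
have nN2 : P.-negligible N2.
  apply: negligible_bigcup_seq => c ccs.
  exists [set t | monomial_sum s (X ^~ t) = c]; split => //; last exact: no_atom.
  have mf : measurable_fun setT (fun t => monomial_sum s (X ^~ t)).
    by apply: measurable_monomial_sum => i; exact: measurable_funP.
  by have := mf measurableT _ (measurable_set1 c); rewrite setTI.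
have sub : disagreement `<=` (N1 `|` N2) `|` \bigcup_m F m.
  move=> t tE; have [tN1|tN1] := pselect (N1 t); first by left; left.
  have [tN2|tN2] := pselect (N2 t); [by left; right|right].
  have tX i : -1 <= X i t < 1.
    have [//|ti] := pselect (-1 <= X i t < 1).
    case: tN1; exists i; first by rewrite /= mem_enum.
    by move=> tXi; apply: ti; move: tXi; rewrite /= in_itv.
  have tcs : monomial_sum s (X ^~ t) \notin cs.
    by apply/negP => tcs; apply: tN2; exists (monomial_sum s (X ^~ t)).
  have cvg_t : (fun L => monomial_sum s (fun i => fine_grid L.+1 (X i t))) @ \oo -->
      monomial_sum s (X ^~ t).
    by apply: cvg_monomial_sum => i; exact: cvg_fine_grid.
  have [m _ mA'] := near_switches_at A_switch tcs cvg_t.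
  exists m => // L mL; rewrite /E /= eq_sym.
  by rewrite [event_after (fine_grid _) t](mA' L mL).
(* Negligible sets come without measurability, so a measurable null superset takes their place. *)
have [Z [mZ PZ0 NZ]] := negligibleU nN1 nN2.
apply: (@le_trans _ _ (P (Z `|` \bigcup_m F m))).
  apply: le_measure; rewrite ?inE //.
  - exact: measurable_disagreement.
  - by apply: measurableU => //; exact: bigcupT_measurable.
  - by apply: subset_trans sub _; exact: setSU.
apply: (le_trans (measureU2 _ _ _)) => //; first exact: bigcupT_measurable.
by rewrite [X in (X + _)%E]PZ0 add0e.
Qed.

Lemma prob_coarse_dist :
  (`| P [set t | event_after coarse t] - P [set t | event_after id t] |
   <= ((N * (size cs * (2 * D)))%:R / M%:R)%:E)%E.
Proof.
have mc := measurable_event_after measurable_coarse.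
have mi := measurable_event_after (@measurable_id _ R setT).
have P_le (S S' : set T) : measurable S -> measurable S' ->
    S `<=` S' `|` disagreement -> (P S <= P S' + P disagreement)%E.
  move=> mS mS' SS'; apply: le_trans (measureU2 _ _ _) => //; last first.
    exact: measurable_disagreement.
  apply: le_measure; rewrite ?inE //; apply: measurableU => //.
  exact: measurable_disagreement.
have := prob_disagreement.
have := P_le _ _ mc mi; have := P_le _ _ mi mc.
rewrite -(fineK (fin_num_measure P _ mc)) -(fineK (fin_num_measure P _ mi)).
rewrite -(fineK (fin_num_measure P _ measurable_disagreement)) -EFinB -!EFinD !lee_fin.
move=> H1 H2 H3; rewrite ler_norml.
have {}H1 := H1 _; have {}H2 := H2 _.
have h1 : [set t | event_after id t] `<=` [set t | event_after coarse t] `|` disagreement.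
  by move=> t /= ti; rewrite /disagreement /= ti; case: event_after; [left|right].
have h2 : [set t | event_after coarse t] `<=` [set t | event_after id t] `|` disagreement.
  by move=> t /= ti; rewrite /disagreement /= ti; case: (event_after id); [left|right].
by have := H1 h1; have := H2 h2; lra.
Qed.

End Coupling.

(** * Intervals with extended real endpoints as switching predicates *)

Section ExtendedInterval.
Variable R : realType.
Implicit Types (a b : \bar R) (A : pred R) (cs : seq R).

(** Comparison with an infinite endpoint has the same truth value at every real number, hence no
    switching point. *)
Definition finite_points a : seq R := if a is r%:E then [:: r] else [::].

Lemma size_finite_points a : (size (finite_points a) <= 1)%N.
Proof. by case: a. Qed.

Lemma switches_at_ge a : switches_at (fun x => (a <= x%:E)%E) (finite_points a).
Proof.
case: a => [r||] x y; rewrite ?leye_eq ?leNye ?eqxx //.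
rewrite !lee_fin; case: (leP x y); case: (leP r x); case: (leP r y) => //= ? ? ? _;
    exists r; rewrite ?mem_head //; apply/andP; split; lra.
Qed.

Lemma switches_at_le b : switches_at (fun x => (x%:E <= b)%E) (finite_points b).
Proof.
case: b => [r||] x y; rewrite ?leey ?leeNy_eq ?eqxx //.
rewrite !lee_fin; case: (leP x y); case: (leP x r); case: (leP y r) => //= ? ? ? _;
    exists r; rewrite ?mem_head //; apply/andP; split; lra.
Qed.

Lemma switches_atI A A' cs cs' : switches_at A cs -> switches_at A' cs' ->
  switches_at (predI A A') (cs ++ cs').
Proof.
move=> AP A'P x y /= xy.
have : (A x != A y) || (A' x != A' y).
  by move: xy; case: (A x); case: (A y); case: (A' x); case: (A' y).
by case/orP=> [/AP|/A'P] [c ccs cb]; exists c; rewrite // mem_cat ccs ?orbT.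
Qed.

Lemma switches_at_itv a b :
  switches_at (fun x => (a <= x%:E <= b)%E) (finite_points a ++ finite_points b).
Proof. exact: switches_atI (@switches_at_ge a) (@switches_at_le b). Qed.

Lemma measurable_ereal_itv a b : measurable [set x : R | (a <= x%:E <= b)%E].
Proof.
rewrite -[X in measurable X]setTI.
rewrite (_ : [set x : R | _] = EFin @^-1` `[a, b]%classic).
  exact: (EFin_measurable measurableT (emeasurable_itv _)).
by apply/seteqP; split=> x /=; rewrite in_itv.
Qed.

End ExtendedInterval.

(** * Normalised integers as points of the cells *)

Section IntegerGrid.
Context (R : realType) (Q : nat).

Definition integer_point (q : 'I_(2 * Q + 1)) : R := (q%:Z - Q%:Z)%:~R.

Lemma integer_point_inj : injective integer_point.
Proof.
move=> q q' /eqP; rewrite eqr_int => /eqP /addIr [qq'].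
exact: val_inj.
Qed.

Lemma trivIset_integer_point : trivIset setT (fun q => [set integer_point q]).
Proof.
by move=> q q' _ _ [x [/= -> /integer_point_inj]].
Qed.

(** The point is -1 + q/Q, and 2q/(2Q+1) <= q/Q <= 2(q+1)/(2Q+1) because 0 <= q <= 2Q. For q = 2Q it
    is the right end 1, which is why closed cells are allowed for [u]. *)
Lemma integer_point_grid (q : 'I_(2 * Q + 1)) : (0 < Q)%N ->
  grid R (2 * Q + 1) q <= Q%:R^-1 * integer_point q <= grid R (2 * Q + 1) q.+1.
Proof.
move=> Q0; have Q0R : (0 : R) < Q%:R by rewrite ltr0n.
have qQ : q%:R <= 2 * Q%:R :> R.
  by rewrite -natrM ler_nat; have := ltn_ord q; lia.
have q0 : 0 <= q%:R :> R by rewrite ler0n.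
rewrite /grid /integer_point -[q.+1%:R]natr1 natrD natrM rmorphB /=.
rewrite -!pmulrn; move: (q%:R : R) (Q%:R : R) Q0R qQ q0 => x y y0 xy x0.
have M0 : 0 < 2 * y + 1 by lra.
have -> : y^-1 * (x - y) = -1 + x / y by field; rewrite gt_eqF.
rewrite !lerD2l; apply/andP; split; rewrite mulrA ler_pdivrMr // mulrAC ler_pdivlMr //; nra.
Qed.

Lemma prob_integer_point (d : measure_display) (T : measurableType d)
    (P : probability T R) (X : {RV P >-> R}) (q : 'I_(2 * Q + 1)) :
  uniform_on_integers X Q ->
  P (X @^-1` [set integer_point q]) = ((2 * Q + 1)%:R^-1)%:E.
Proof.
by apply; have := ltn_ord q; lia.
Qed.

End IntegerGrid.

(** * The discrepancy for a fixed Q and a fixed interval *)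

Section FixedLaw.
Context (R : realType) (n : nat) (s : seq (R * {ffun 'I_n.+1 -> nat})) (D : nat).
Hypotheses (sE : forall a, @discriminant R n a = monomial_sum s a)
  (sD : forall m i, m \in s -> (m.2 i <= D)%N).
Context (d : measure_display) (T : measurableType d) (P : probability T R)
  (xi : 'I_n.+1 -> {RV P >-> R}) (phi : R -> R).
Hypotheses (xi_indep : mutually_independent xi)
  (xiU : forall i, uniform_on_interval (xi i) (-1) 1)
  (xi_phi : has_density P (fun t => discriminant (fun i => xi i t)) phi).
Context (Q : nat) (d' : measure_display) (T' : measurableType d')
  (P' : probability T' R) (xiQ : 'I_n.+1 -> {RV P' >-> R}).
Hypotheses (Q0 : (0 < Q)%N) (xiQ_indep : mutually_independent xiQ)
  (xiQU : forall i, uniform_on_integers (xiQ i) Q).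
Variables a b : \bar R.

Let A (x : R) : bool := (a <= x%:E <= b)%E.
Let u (q : 'I_(2 * Q + 1)) : R := Q%:R^-1 * integer_point R q.
Let M0 : (0 < 2 * Q + 1)%N. Proof. by rewrite addn1. Qed.

(** Homogeneity moves the factor Q^(2n-2) into the coefficients, after which both sides are the
    proportion of the same index functions [f]. *)
Lemma prob_integer_discriminant :
  P' [set t | (a <= (discriminant (fun i => xiQ i t) / Q%:R ^+ (2 * n - 2))%:E <= b)%E]
  = P [set t | event_after xi s A (coarse u) t].
Proof.
have QR0 : Q%:R != 0 :> R by rewrite pnatr_eq0 -lt0n.
pose f (k : {ffun 'I_n.+1 -> 'I_(2 * Q + 1)}) : bool := A (monomial_sum s (u \o k)).
have cardM : #|{: 'I_(2 * Q + 1)}| = (2 * Q + 1)%N by rewrite card_ord.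
rewrite (@prob_cells _ _ _ _ _ _ _ (fun q : 'I_(2 * Q + 1) => cell (2 * Q + 1) q)
  xi_indep _ _ _ _ _ f); first last.
- move=> k t kt; rewrite /f /= (@event_afterE _ _ _ _ _ _ _ _ _ t (u \o k)) // => i.
  by rewrite /coarse (stepE u (k := k i)) //; exact: trivIset_coarse.
- apply: measurable_event_after; last exact: measurable_coarse.
  exact: measurable_ereal_itv.
- by move=> i k; rewrite cardM; exact: prob_cell.
- by rewrite cardM.
- exact: trivIset_coarse.
- by move=> k; exact: measurable_itv.
apply: (@prob_cells _ _ _ _ _ _ _ (fun q => [set integer_point R q]) xiQ_indep).
- by move=> k; exact: measurable_set1.
- exact: trivIset_integer_point.
- by rewrite cardM.
- by move=> i k; rewrite cardM; exact: prob_integer_point.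
- under eq_set do rewrite sE.
  have mf : measurable_fun setT
      (fun t => monomial_sum s (xiQ ^~ t) / Q%:R ^+ (2 * n - 2)).
    apply: measurable_funM => //; apply: measurable_monomial_sum => i.
    exact: measurable_funP.
  have := mf measurableT _ (measurable_ereal_itv a b); rewrite setTI.
  exact.
- move=> k t kt; rewrite /f /A /=.
  have -> : (fun i => xiQ i t) = (fun i => Q%:R * (u \o k) i).
    by apply/funext => i; rewrite /= /u mulVKf // kt.
  rewrite DiscriminantPolynomial.discriminantZ // sE mulrC mulKf //.
  by rewrite expf_neq0.
Qed.

Lemma prob_uniform_discriminant :
  P [set t | event_after xi s A id t]
  = (\int[lebesgue_measure]_(x in [set x : R | (a <= x%:E <= b)%E]) (phi x)%:E)%E.
Proof.
case: xi_phi => _ _ <-; last exact: measurable_ereal_itv.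
by congr (P _); apply/seteqP; split=> t /=; rewrite /event_after /A sE.
Qed.

(** The constant multiplies the n+1 coordinates, at most two finite endpoints, two parity classes of
    cells and the degree bound D. *)
Lemma discriminant_discrepancy :
  (`| P' [set t | (a <= (discriminant (fun i => xiQ i t)
                          / Q%:R ^+ (2 * n - 2))%:E <= b)%E]
      - \int[lebesgue_measure]_(x in [set x : R | (a <= x%:E <= b)%E]) (phi x)%:E |
   <= ((n.+1 * (2 * (2 * D)))%:R / (2 * Q + 1)%:R)%:E)%E.
Proof.
rewrite prob_integer_discriminant -prob_uniform_discriminant.
(* Singletons are Lebesgue null, so a law with a density has no atom. *)
have no_atom c : c \in finite_points a ++ finite_points b ->
    P [set t | monomial_sum s (xi ^~ t) = c] = 0%E.
  move=> _; case: xi_phi => _ _ /(_ _ (measurable_set1 c)).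
  rewrite integral_set1 => <-; congr (P _).
  by apply/seteqP; split=> t /=; rewrite sE.
apply: le_trans (prob_coarse_dist xi_indep xiU sD (switches_at_itv (a:=a) (b:=b))
  (measurable_ereal_itv a b) M0 _ no_atom) _.
  by move=> q; exact: integer_point_grid.
rewrite lee_fin ler_pM2r ?invr_gt0 ?ltr0n // ler_nat leq_mul2l /= leq_mul2r.
by rewrite size_cat (leq_add (size_finite_points a) (size_finite_points b)) orbT.
Qed.

End FixedLaw.

(** * The supremum over all intervals *)

Theorem theorem2p1 (R : realType) (n : nat) (hn : (2 <= n)%N) :
  exists C : R, 0 < C /\
    forall (d : measure_display) (T : measurableType d) (P : probability T R)
      (xi : 'I_n.+1 -> {RV P >-> R}) (phi : R -> R),
      mutually_independent xi ->
      (forall i, uniform_on_interval (xi i) (-1) 1) ->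
      has_density P (fun t => discriminant (fun i => xi i t)) phi ->
    forall (Q : nat), (2 <= Q)%N ->
    forall (d' : measure_display) (T' : measurableType d')
      (P' : probability T' R) (xiQ : 'I_n.+1 -> {RV P' >-> R}),
      mutually_independent xiQ ->
      (forall i, uniform_on_integers (xiQ i) Q) ->
    (ereal_sup
      [set r | exists a b : \bar R, a <= b /\
        r = `| P' [set t | a <= (discriminant (fun i => xiQ i t)
                                   / Q%:R ^+ (2 * n - 2))%:E <= b]
               - \int[lebesgue_measure]_(x in [set x : R | a <= x%:E <= b])
                   (phi x)%:E |]
      <= (C / ln Q%:R)%:E)%E.
Proof.
have [s sE] := DiscriminantPolynomial.discriminant_monomial_sum R n.
(* The largest exponent of a single variable, fixed before Q and the random variables are
   introduced. *)
pose D := (\max_(m <- s) \max_i m.2 i)%N.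
have sD m i : m \in s -> (m.2 i <= D)%N.
  move=> ms; apply: (@leq_trans (\max_i m.2 i)); first exact: leq_bigmax.
  exact: (leq_bigmax_seq (F := fun m : R * {ffun 'I_n.+1 -> nat} => \max_i m.2 i)).
(* The successor makes the constant positive whatever D is. *)
exists (n.+1 * (2 * (2 * D))).+1%:R; split; first by rewrite ltr0n.
move=> d T P xi phi xi_indep xiU xi_phi Q Q2 d' T' P' xiQ xiQ_indep xiQU.
have Q0 : (0 < Q)%N by apply: leq_trans Q2.
apply: ge_ereal_sup => _ [a [b [_ ->]]].
apply: (le_trans (discriminant_discrepancy sE sD xi_indep xiU xi_phi Q0 xiQ_indep xiQU a b)).
have lnQ0 : 0 < ln Q%:R :> R by rewrite ln_gt0 // ltr1n.
rewrite lee_fin ler_pM ?ler_nat ?invr_ge0 ?ler0n // lef_pV2 ?posrE ?ltr0n ?addn1 //.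
(* The stronger bound of order 1/Q suffices, since ln Q < Q <= 2Q + 1. *)
apply: (le_trans (ltW (ln_sublinear _))); first by rewrite ltr0n.
by rewrite ler_nat mulSn mul1n -addnS leq_addr.
Qed.
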